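(* Let $m\geq 1$ be an integer, let $p_-,q_-,p_+,q_+$ be real parameters with $-1<p_\pm\leq q_\pm<1$, and put $a_\pm=p_\pm q_\pm$, $b_\pm=p_\pm+q_\pm$. Then the functions $\psi^{(m)}_{\hat l}$, $\hat l\in\Lambda^{(m)}$ (defined in the context), satisfy the following orthogonality relations: for all $\hat l,\hat k\in\Lambda^{(m)}=\{0,1,\ldots,m\}$, $$\sum_{l\in\Lambda^{(m)}}\psi^{(m)}_{\hat l}(l)\,\psi^{(m)}_{\hat k}(l)\,\Delta^{(m)}_l=\begin{cases}0&\text{if }\hat k\neq\hat l,\\ 1/\hat\Delta^{(m)}_{\hat l}&\text{if }\hat k=\hat l,\end{cases}$$ where $$\hat\Delta^{(m)}_{\hat l}:=\frac{1}{c(\xi^{(m)}_{\hat l})\,c(-\xi^{(m)}_{\hat l})\,H^{(m)}(\xi^{(m)}_{\hat l})},\qquad H^{(m)}(\xi):=2m+v'_{p_-}(\xi)+v'_{q_-}(\xi)+v'_{p_+}(\xi)+v'_{q_+}(\xi),$$ and the prime denotes the derivative.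
   Context: Notation. $\Lambda^{(m)}:=\{0,1,\ldots,m\}$. $\delta_l:=1$ if $l=0$ and $\delta_l:=0$ for every nonzero integer $l$. For $-1<q<1$ and $\xi\in\mathbb{R}$, $$v_q(\xi):=\int_0^\xi\frac{1-q^2}{1-2q\cos(x)+q^2}\,dx .$$ The function $v_q$ is odd, strictly increasing, and $v_q(\xi+2\pi)=v_q(\xi)+2\pi$. For $\hat l\in\Lambda^{(m)}$, $\xi^{(m)}_{\hat l}$ denotes the unique real solution $\xi$ of $$2m\xi+v_{p_-}(\xi)+v_{q_-}(\xi)+v_{p_+}(\xi)+v_{q_+}(\xi)=2\pi(\hat l+1);$$ one has $0<\xi^{(m)}_0<\xi^{(m)}_1<\cdots<\xi^{(m)}_m<\pi$. The function $c$ and the two-parameter Bernstein-Szegő polynomials $p_l(\xi)$ ($l\in\mathbb{Z}$) are $$c(\xi):=\frac{(1-p_-e^{-i\xi})(1-q_-e^{-i\xi})}{1-e^{-2i\xi}},$$ $$p_l(\xi):=c(\xi)e^{il\xi}+c(-\xi)e^{-il\xi}=U_l(\cos\xi)-b_-U_{l-1}(\cos\xi)+a_-U_{l-2}(\cos\xi),$$ where $U_l(\cos\xi):=\sin((l+1)\xi)/\sin(\xi)$ for $l\in\mathbb{Z}$. (The polynomials $p_l(\xi)$ are not to be confused with the parameters $p_\pm$.) The functions $\psi^{(m)}_{\hat l}:\Lambda^{(m)}\to\mathbb{C}$ are $\psi^{(m)}_{\hat l}(l):=p_l(\xi^{(m)}_{\hat l})$ for $\hat l,l\in\Lambda^{(m)}$.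 The weights are $\Delta^{(m)}_l:=(1-a_-\delta_l)^{-1}(1-a_+\delta_{m-l})^{-1}$ for $l\in\Lambda^{(m)}$. *)

(* Defs.v *)
From Stdlib Require Import Reals ZArith Lra Lia.
From Coquelicot Require Import Coquelicot.
Open Scope R_scope.

(* Throughout, pm, qm, pp, qp stand for p_-, q_-, p_+, q_+, so that
   a_- = pm * qm and a_+ = pp * qp. *)

Definition vq (q xi : R) : R :=
  RInt (fun x => (1 - q ^ 2) / (1 - 2 * q * cos x + q ^ 2)) 0 xi.

Definition bethe (pm qm pp qp : R) (m : nat) (xi : R) : R :=
  2 * INR m * xi + vq pm xi + vq qm xi + vq pp xi + vq qp xi.

(* [iota] is Coquelicot's definite description operator; [node_spec] and
   [node_unique] show that it picks out an actual, unique solution. *)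
Definition node (pm qm pp qp : R) (m lhat : nat) : R :=
  iota (fun xi => bethe pm qm pp qp m xi = 2 * PI * (INR lhat + 1)).

Definition Hfun (pm qm pp qp : R) (m : nat) (xi : R) : R :=
  2 * INR m + Derive (vq pm) xi + Derive (vq qm) xi
            + Derive (vq pp) xi + Derive (vq qp) xi.

(* exp (i x) for real x *)
Definition expi (x : R) : C := (cos x, sin x).

Definition cfun (pm qm xi : R) : C :=
  ((1 - RtoC pm * expi (- xi)) * (1 - RtoC qm * expi (- xi))
   / (1 - expi (- (2 * xi))))%C.

Definition bs_poly (pm qm : R) (l : Z) (xi : R) : C :=
  (cfun pm qm xi * expi (IZR l * xi)
   + cfun pm qm (- xi) * expi (- (IZR l * xi)))%C.

Definition bs_psi (pm qm pp qp : R) (m lhat l : nat) : C :=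
  bs_poly pm qm (Z.of_nat l) (node pm qm pp qp m lhat).

Definition kron0 (l : Z) : R := if Z.eq_dec l 0 then 1 else 0.

Definition weight (pm qm pp qp : R) (m l : nat) : R :=
  / (1 - pm * qm * kron0 (Z.of_nat l))
  * / (1 - pp * qp * kron0 (Z.of_nat m - Z.of_nat l)).

Definition dual_weight (pm qm pp qp : R) (m lhat : nat) : C :=
  let xi := node pm qm pp qp m lhat in
  (1 / (cfun pm qm xi * cfun pm qm (- xi) * RtoC (Hfun pm qm pp qp m xi)))%C.

Lemma vq_den_pos q x : -1 < q < 1 -> 0 < 1 - 2 * q * cos x + q ^ 2.
Proof.
intros Hq; pose proof (COS_bound x).
destruct (Rle_dec 0 q); nra.
Qed.

Lemma vq_integrand_pos q x : -1 < q < 1 ->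
  0 < (1 - q ^ 2) / (1 - 2 * q * cos x + q ^ 2).
Proof.
intros Hq; apply Rdiv_lt_0_compat; [nra | now apply vq_den_pos].
Qed.

Lemma vq_integrand_continuous q x : -1 < q < 1 ->
  continuous (fun x => (1 - q ^ 2) / (1 - 2 * q * cos x + q ^ 2)) x.
Proof.
intros Hq; apply (ex_derive_continuous (V := R_NormedModule)); auto_derive.
pose proof (vq_den_pos q x Hq); apply Rgt_not_eq; simpl in *; lra.
Qed.

Lemma is_derive_vq q x : -1 < q < 1 ->
  is_derive (vq q) x ((1 - q ^ 2) / (1 - 2 * q * cos x + q ^ 2)).
Proof.
intros Hq; apply (is_derive_RInt
  (fun x => (1 - q ^ 2) / (1 - 2 * q * cos x + q ^ 2)) (vq q) 0 x).
- exists posreal_one; intros y _; apply (RInt_correct (V := R_CompleteNormedModule)).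
  apply (ex_RInt_continuous (V := R_CompleteNormedModule)).
  intros z _; now apply vq_integrand_continuous.
- now apply vq_integrand_continuous.
Qed.

Lemma vq_increasing q x y : -1 < q < 1 -> x < y -> vq q x < vq q y.
Proof.
intros Hq Hxy.
destruct (MVT_gen (vq q) x y
  (fun x => (1 - q ^ 2) / (1 - 2 * q * cos x + q ^ 2))) as (z & _ & Hz).
- intros; now apply is_derive_vq.
- intros; apply continuity_pt_filterlim.
  apply (ex_derive_continuous (V := R_NormedModule)).
  eexists; now apply is_derive_vq.
- pose proof (vq_integrand_pos q z Hq); nra.
Qed.

Lemma vq_0 q : vq q 0 = 0.
Proof. apply (RInt_point (V := R_CompleteNormedModule)). Qed.

Lemma bethe_increasing pm qm pp qp m x y :
  -1 < pm < 1 -> -1 < qm < 1 -> -1 < pp < 1 -> -1 < qp < 1 ->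
  x < y ->
  bethe pm qm pp qp m x < bethe pm qm pp qp m y.
Proof.
intros Hpm Hqm Hpp Hqp Hxy; unfold bethe.
pose proof (vq_increasing pm x y Hpm Hxy); pose proof (vq_increasing qm x y Hqm Hxy).
pose proof (vq_increasing pp x y Hpp Hxy); pose proof (vq_increasing qp x y Hqp Hxy).
pose proof (pos_INR m); nra.
Qed.

Lemma bethe_continuity pm qm pp qp m :
  -1 < pm < 1 -> -1 < qm < 1 -> -1 < pp < 1 -> -1 < qp < 1 ->
  continuity (bethe pm qm pp qp m).
Proof.
intros Hpm Hqm Hpp Hqp x; apply continuity_pt_filterlim.
apply (ex_derive_continuous (V := R_NormedModule)); unfold bethe.
auto_derive; repeat split; try (eexists; now apply is_derive_vq).
Qed.

Lemma node_unique pm qm pp qp m lhat :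
  -1 < pm < 1 -> -1 < qm < 1 -> -1 < pp < 1 -> -1 < qp < 1 ->
  (1 <= m)%nat -> exists! xi,
  bethe pm qm pp qp m xi = 2 * PI * (INR lhat + 1).
Proof.
intros Hpm Hqm Hpp Hqp Hm.
set (T := 2 * PI * (INR lhat + 1)).
assert (HT : 0 < T).
{ unfold T; pose proof PI_RGT_0; pose proof (pos_INR lhat).
  apply Rmult_lt_0_compat; lra. }
assert (H0 : bethe pm qm pp qp m 0 = 0) by (unfold bethe; rewrite !vq_0; ring).
assert (H1 : T <= bethe pm qm pp qp m T).
{ unfold bethe.
  pose proof (vq_increasing pm 0 T Hpm HT); pose proof (vq_increasing qm 0 T Hqm HT).
  pose proof (vq_increasing pp 0 T Hpp HT); pose proof (vq_increasing qp 0 T Hqp HT).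
  rewrite vq_0 in *; apply le_INR in Hm; simpl in Hm; nra. }
destruct (IVT_gen (bethe pm qm pp qp m) 0 T T) as (x & _ & Hx).
{ now apply bethe_continuity. }
{ rewrite H0, Rmin_left, Rmax_right; lra. }
exists x; split; [exact Hx |].
intros y Hy; destruct (Rtotal_order x y) as [h | [h | h]]; auto;
  apply (bethe_increasing pm qm pp qp m) in h; trivial; lra.
Qed.

Lemma node_spec pm qm pp qp m lhat :
  -1 < pm < 1 -> -1 < qm < 1 -> -1 < pp < 1 -> -1 < qp < 1 ->
  (1 <= m)%nat ->
  bethe pm qm pp qp m (node pm qm pp qp m lhat) = 2 * PI * (INR lhat + 1).
Proof.
intros; apply (iota_correct (V := R_CompleteNormedModule)
  (fun xi => bethe pm qm pp qp m xi = 2 * PI * (INR lhat + 1))).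
now apply node_unique.
Qed.

(* Main.v *)
Require Import Defs.
From Stdlib Require Import Reals.
From Coquelicot Require Import Coquelicot.
From Stdlib Require Import ZArith Lra Lia.
(** Since exp(i v_q(x)) = exp(ix) (1 - q exp(-ix)) / (1 - q exp(ix)), the number v_q(x)/2 is
    the argument of exp(ix/2) (1 - q exp(-ix)).  In polar form, therefore,
    sin x (p_{m+1} - b_+ p_m + a_+ p_{m-1}) is a positive modulus times the sine of half the
    left-hand side of the node equation, so it vanishes at the nodes.  By the
    Christoffel-Darboux formula, whose boundary terms are absorbed by the weights at 0 and m,
    2 (cos x - cos y) times the kernel sum at a node x is proportional to the value at y of
    that boundary expression: this gives orthogonality when y is another node, and the norm
    by differentiating in y at y = x. *)

Open Scope R_scope.

(** * Polar form of a single factor 1 - q exp(-ix) *)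

Definition vq_den (q x : R) : R := 1 - 2 * q * cos x + q ^ 2.

Lemma is_derive_zero_const (f : R -> R) (x y : R) :
  (forall t, is_derive f t 0) -> f x = f y.
Proof.
intros Hf.
destruct (MVT_gen f x y (fun _ => 0)) as (z & _ & Hz).
- intros; apply Hf.
- intros; apply continuity_pt_filterlim.
  apply (ex_derive_continuous (V := R_NormedModule)); eexists; apply Hf.
- lra.
Qed.

(** The last clause is oriented as a rewrite rule for [ring], so that half-angle identities become
    polynomial identities in cos (x/2) and sin (x/2). *)
Lemma cos_sin_half (x : R) :
  cos x = cos (x / 2) ^ 2 - sin (x / 2) ^ 2 /\ sin x = 2 * sin (x / 2) * cos (x / 2)
  /\ sin (x / 2) ^ 2 = 1 - cos (x / 2) ^ 2.
Proof.
pose proof (sin2_cos2 (x / 2)) as H; unfold Rsqr in H.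
replace (cos x) with (cos (2 * (x / 2))) by (f_equal; field).
replace (sin x) with (sin (2 * (x / 2))) by (f_equal; field).
rewrite cos_2a, sin_2a; repeat split; nra.
Qed.

(** The quotient f / r has derivative zero, hence is constant. *)
Lemma linear_ode_proportional (f r g : R -> R) (x y : R) :
  (forall t, is_derive f t (g t * f t)) -> (forall t, is_derive r t (g t * r t)) ->
  (forall t, r t <> 0) -> f x * r y = f y * r x.
Proof.
intros Hf Hr Hnz.
assert (H : f x / r x = f y / r y).
{ apply (is_derive_zero_const (fun t => f t / r t)); intros t.
  evar_last; [apply (is_derive_div f r t _ _ (Hf t) (Hr t) (Hnz t)) |].
  simpl; field; apply Hnz. }
apply (f_equal (fun z => z * r x * r y)) in H.
field_simplify in H; auto; lra.
Qed.

(* The real and the imaginary part of (1 - q exp(-ix)) exp(ix/2) exp(-i v_q(x)/2)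
   satisfy the same first-order linear equation as the modulus of 1 - q exp(-ix). *)
Lemma vq_polar (q x : R) : -1 < q < 1 ->
  (1 - q) * cos (x / 2) = sqrt (vq_den q x) * cos (vq q x / 2) /\
  (1 + q) * sin (x / 2) = sqrt (vq_den q x) * sin (vq q x / 2).
Proof.
intros Hq.
set (A := fun t => (1 - q) * cos (t / 2) * cos (vq q t / 2)
                   + (1 + q) * sin (t / 2) * sin (vq q t / 2)).
set (B := fun t => (1 + q) * sin (t / 2) * cos (vq q t / 2)
                   - (1 - q) * cos (t / 2) * sin (vq q t / 2)).
set (r := fun t => sqrt (vq_den q t)).
(* [g] is the logarithmic derivative of [r]. *)
set (g := fun t => q * sin t / vq_den q t).
assert (HD : forall t, 0 < vq_den q t) by (intros; now apply vq_den_pos).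
assert (HS : forall t, 0 < r t) by (intros; now apply sqrt_lt_R0).
assert (Hv : forall t, Derive (fun u => vq q u) t = (1 - q ^ 2) / vq_den q t)
  by (intros; now apply is_derive_unique, is_derive_vq).
assert (Hex : forall t, ex_derive (vq q) t)
  by (intros; eexists; now apply is_derive_vq).
assert (Hr : forall t, is_derive r t (g t * r t)).
{ intros t; pose proof (HD t) as h1; pose proof (HS t) as h2.
  evar_last.
  - apply is_derive_sqrt; [| exact h1].
    unfold vq_den; auto_derive; trivial.
  - unfold g; fold (r t).
    assert (E : vq_den q t = r t * r t) by (symmetry; apply sqrt_sqrt; lra).
    rewrite E; field; lra. }
assert (HA : forall t, is_derive A t (g t * A t)).
{ intros t; unfold A, g; pose proof (HD t); auto_derive; [auto |].
  rewrite Hv; destruct (cos_sin_half t) as (Hc & Hs & Hss).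
  fold (Rdiv t 2) (Rdiv (vq q t) 2); rewrite Hs.
  assert (HDe : vq_den q t = 1 - 2 * q * (cos (t / 2) ^ 2 - sin (t / 2) ^ 2) + q ^ 2)
    by (unfold vq_den; now rewrite Hc).
  set (D := vq_den q t) in *; set (c := cos (t / 2)) in *; set (s := sin (t / 2)) in *.
  field_simplify_eq; [| lra]; rewrite HDe; ring [Hss]. }
assert (HB : forall t, is_derive B t (g t * B t)).
{ intros t; unfold B, g; pose proof (HD t); auto_derive; [auto |].
  rewrite Hv; destruct (cos_sin_half t) as (Hc & Hs & Hss).
  fold (Rdiv t 2) (Rdiv (vq q t) 2); rewrite Hs.
  assert (HDe : vq_den q t = 1 - 2 * q * (cos (t / 2) ^ 2 - sin (t / 2) ^ 2) + q ^ 2)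
    by (unfold vq_den; now rewrite Hc).
  set (D := vq_den q t) in *; set (c := cos (t / 2)) in *; set (s := sin (t / 2)) in *.
  field_simplify_eq; [| lra]; rewrite HDe; ring [Hss]. }
assert (H0 : r 0 = 1 - q).
{ unfold r, vq_den; rewrite cos_0; replace (1 - 2 * q * 1 + q ^ 2) with ((1 - q) ^ 2) by ring.
  apply sqrt_pow2; lra. }
assert (Hnz : forall t, r t <> 0) by (intros t; pose proof (HS t); lra).
pose proof (linear_ode_proportional A r g x 0 HA Hr Hnz) as HA1.
pose proof (linear_ode_proportional B r g x 0 HB Hr Hnz) as HB1.
unfold A, B in HA1, HB1; rewrite H0, vq_0 in HA1, HB1.
replace (0 / 2) with 0 in HA1, HB1 by field; rewrite cos_0, sin_0 in HA1, HB1.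
pose proof (sin2_cos2 (vq q x / 2)) as Hcs; unfold Rsqr in Hcs.
fold (r x).
set (c := cos (x / 2)) in *; set (s := sin (x / 2)) in *.
set (C := cos (vq q x / 2)) in *; set (S := sin (vq q x / 2)) in *.
(* At 0 the function [A] equals [r] and [B] vanishes, so proportionality to [r] gives A = r and B =
   0 everywhere. *)
assert (HA2 : (1 - q) * c * C + (1 + q) * s * S = r x)
  by (apply (Rmult_eq_reg_r (1 - q)); lra).
assert (HB2 : (1 + q) * s * C - (1 - q) * c * S = 0)
  by (apply (Rmult_eq_reg_r (1 - q)); lra).
split.
(* The pair (A, B) arises by rotation through the angle -v_q(x)/2; rotating back recovers the two
   original coordinates. *)
- transitivity (((1 - q) * c * C + (1 + q) * s * S) * C - ((1 + q) * s * C - (1 - q) * c * S) * S).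
  + transitivity ((1 - q) * c * (S * S + C * C)); [rewrite Hcs |]; ring.
  + rewrite HA2, HB2; ring.
- transitivity (((1 - q) * c * C + (1 + q) * s * S) * S + ((1 + q) * s * C - (1 - q) * c * S) * C).
  + transitivity ((1 + q) * s * (S * S + C * C)); [rewrite Hcs |]; ring.
  + rewrite HA2, HB2; ring.
Qed.

(** * Location and separation of the nodes *)

Lemma vq_PI (q : R) : -1 < q < 1 -> vq q PI = PI.
Proof.
intros Hq; pose proof PI_RGT_0 as Hpi.
destruct (vq_polar q PI Hq) as [Hc _].
assert (HS : 0 < sqrt (vq_den q PI)) by (now apply sqrt_lt_R0, vq_den_pos).
rewrite cos_PI2 in Hc.
assert (Hc0 : cos (vq q PI / 2) = 0) by nra.
pose proof (vq_increasing q 0 PI Hq Hpi) as Hpos; rewrite vq_0 in Hpos.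
(* A value in (0, PI) would make the cosine of its half positive. A value above PI would force
   v_q(x) = PI at some x in (0, PI), and the polar form at x would give cos (x/2) = 0. *)
destruct (Rtotal_order (vq q PI) PI) as [h | [h | h]]; auto; exfalso.
- pose proof (cos_gt_0 (vq q PI / 2)); lra.
- destruct (IVT_gen (vq q) 0 PI PI) as (x & Hx & Hvx).
  + intros t; apply continuity_pt_filterlim.
    apply (ex_derive_continuous (V := R_NormedModule)); eexists; now apply is_derive_vq.
  + rewrite vq_0, Rmin_left, Rmax_right; lra.
  + rewrite Rmin_left, Rmax_right in Hx by lra.
    destruct (vq_polar q x Hq) as [Hx2 _].
    rewrite Hvx, cos_PI2 in Hx2.
    assert (x <> PI) by (intros ->; lra).
    pose proof (cos_gt_0 (x / 2)); nra.
Qed.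

(** The strictly increasing [bethe] runs from 0 at 0 to 2 PI (m + 2) at PI, and the target 2 PI
    (lhat + 1) lies strictly between. *)
Lemma node_bounds (pm qm pp qp : R) (m lhat : nat) :
  -1 < pm < 1 -> -1 < qm < 1 -> -1 < pp < 1 -> -1 < qp < 1 ->
  (1 <= m)%nat -> (lhat <= m)%nat -> 0 < node pm qm pp qp m lhat < PI.
Proof.
intros Hpm Hqm Hpp Hqp Hm Hl; pose proof PI_RGT_0 as Hpi.
pose proof (node_spec pm qm pp qp m lhat Hpm Hqm Hpp Hqp Hm) as Hn.
set (x := node pm qm pp qp m lhat) in *.
apply le_INR in Hl; pose proof (pos_INR lhat).
assert (H0 : bethe pm qm pp qp m 0 = 0) by (unfold bethe; rewrite !vq_0; ring).
assert (H1 : bethe pm qm pp qp m PI = 2 * PI * (INR m + 2))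
  by (unfold bethe; rewrite !vq_PI by assumption; ring).
split.
- destruct (Rtotal_order 0 x) as [h | [h | h]]; auto; exfalso.
  + rewrite <- h in Hn; nra.
  + apply (bethe_increasing pm qm pp qp m) in h; trivial; nra.
- destruct (Rtotal_order x PI) as [h | [h | h]]; auto; exfalso.
  + rewrite h in Hn; nra.
  + apply (bethe_increasing pm qm pp qp m) in h; trivial; nra.
Qed.

(** Cosine is injective on (0, PI), and the node equation recovers the index from the node. *)
Lemma cos_node_inj (pm qm pp qp : R) (m lhat khat : nat) :
  -1 < pm < 1 -> -1 < qm < 1 -> -1 < pp < 1 -> -1 < qp < 1 ->
  (1 <= m)%nat -> (lhat <= m)%nat -> (khat <= m)%nat ->
  cos (node pm qm pp qp m lhat) = cos (node pm qm pp qp m khat) -> lhat = khat.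
Proof.
intros Hpm Hqm Hpp Hqp Hm Hl Hk Hcos; pose proof PI_RGT_0 as Hpi.
pose proof (node_bounds pm qm pp qp m lhat Hpm Hqm Hpp Hqp Hm Hl).
pose proof (node_bounds pm qm pp qp m khat Hpm Hqm Hpp Hqp Hm Hk).
apply cos_inj in Hcos; try lra.
pose proof (node_spec pm qm pp qp m lhat Hpm Hqm Hpp Hqp Hm) as Hn1.
pose proof (node_spec pm qm pp qp m khat Hpm Hqm Hpp Hqp Hm) as Hn2.
rewrite Hcos in Hn1; apply INR_eq; nra.
Qed.

(** * Two-parameter polar form and real form of the polynomials *)

Definition modulus (p q x : R) : R := sqrt (vq_den p x) * sqrt (vq_den q x).

Definition phase (p q x : R) : R := (vq p x + vq q x) / 2.

Lemma modulus_pos (p q x : R) : -1 < p < 1 -> -1 < q < 1 -> 0 < modulus p q x.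
Proof.
intros Hp Hq; apply Rmult_lt_0_compat; now apply sqrt_lt_R0, vq_den_pos.
Qed.

(* Real and imaginary parts of exp(ix) (1 - p exp(-ix)) (1 - q exp(-ix)). *)
Lemma modulus_phase (p q x : R) : -1 < p < 1 -> -1 < q < 1 ->
  (1 + p * q) * cos x - (p + q) = modulus p q x * cos (phase p q x) /\
  (1 - p * q) * sin x = modulus p q x * sin (phase p q x).
Proof.
intros Hp Hq.
destruct (vq_polar p x Hp) as [Hpc Hps]; destruct (vq_polar q x Hq) as [Hqc Hqs].
destruct (cos_sin_half x) as (Hc & Hs & Hss).
unfold phase, modulus; replace ((vq p x + vq q x) / 2) with (vq p x / 2 + vq q x / 2) by field.
rewrite cos_plus, sin_plus; split.
- transitivity (((1 - p) * cos (x / 2)) * ((1 - q) * cos (x / 2))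
    - ((1 + p) * sin (x / 2)) * ((1 + q) * sin (x / 2))); [| rewrite Hpc, Hqc, Hps, Hqs; ring].
  rewrite Hc; ring [Hss].
- transitivity (((1 + p) * sin (x / 2)) * ((1 - q) * cos (x / 2))
    + ((1 - p) * cos (x / 2)) * ((1 + q) * sin (x / 2))); [| rewrite Hpc, Hqc, Hps, Hqs; ring].
  rewrite Hs; ring.
Qed.

(** This is sin x times p_l(x), as [bs_poly_eq] shows. The index is real so that shifts by one are
    plain additions. *)
Definition sin_bs (p q l x : R) : R :=
  (1 - p * q) * sin x * cos (l * x) + ((1 + p * q) * cos x - (p + q)) * sin (l * x).

(** Since 1 - exp(-2ix) = 2i sin x exp(-ix), c(x) is exp(ix) (1 - p exp(-ix)) (1 - q exp(-ix))
    divided by 2i sin x. *)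
Lemma cfun_eq (p q x : R) : sin x <> 0 ->
  cfun p q x = ((1 - p * q) / 2, - ((1 + p * q) * cos x - (p + q)) / (2 * sin x)).
Proof.
intros Hs; unfold cfun.
pose proof (sin2_cos2 x) as Hcs; unfold Rsqr in Hcs.
assert (HD : (1 - expi (- (2 * x)))%C = (2 * sin x * sin x, 2 * sin x * cos x)).
{ unfold expi; rewrite cos_neg, sin_neg, cos_2a_sin, sin_2a.
  apply injective_projections; simpl; ring. }
assert (Hnz : (1 - expi (- (2 * x)) <> 0)%C).
{ rewrite HD; intros H; injection H; intros H1 H2; nra. }
set (v := ((1 - p * q) / 2, - ((1 + p * q) * cos x - (p + q)) / (2 * sin x)) : C).
transitivity (v * (1 - expi (- (2 * x))) / (1 - expi (- (2 * x))))%C; [| field; exact Hnz].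
apply (f_equal (fun z => Cdiv z (1 - expi (- (2 * x)))%C)).
rewrite HD; unfold v, expi; rewrite cos_neg, sin_neg.
assert (Hss : sin x * sin x = 1 - cos x * cos x) by lra.
apply injective_projections; simpl; field_simplify; trivial; ring [Hss].
Qed.

Lemma bs_poly_eq (p q x : R) (l : Z) : sin x <> 0 ->
  bs_poly p q l x = RtoC (sin_bs p q (IZR l) x / sin x).
Proof.
intros Hs; unfold bs_poly.
assert (Hs' : sin (- x) <> 0) by (rewrite sin_neg; lra).
rewrite (cfun_eq p q x Hs), (cfun_eq p q (- x) Hs'); unfold expi, sin_bs.
rewrite !cos_neg, !sin_neg.
apply injective_projections; simpl; field; lra.
Qed.

Lemma sin_bs_0 (p q x : R) : sin_bs p q 0 x = (1 - p * q) * sin x.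
Proof. unfold sin_bs; rewrite Rmult_0_l, cos_0, sin_0; ring. Qed.

Lemma sin_bs_1 (p q x : R) : sin_bs p q 1 x = sin x * (2 * cos x - (p + q)).
Proof. unfold sin_bs; rewrite Rmult_1_l; ring. Qed.

Lemma sin_bs_rec (p q l x : R) :
  sin_bs p q (l + 1) x + sin_bs p q (l - 1) x = 2 * cos x * sin_bs p q l x.
Proof.
unfold sin_bs.
replace ((l + 1) * x) with (l * x + x) by ring.
replace ((l - 1) * x) with (l * x - x) by ring.
rewrite cos_plus, cos_minus, sin_plus, sin_minus; ring.
Qed.

Lemma sin_bs_polar (p q l x : R) : -1 < p < 1 -> -1 < q < 1 ->
  sin_bs p q l x = modulus p q x * sin (l * x + phase p q x).
Proof.
intros Hp Hq; unfold sin_bs; destruct (modulus_phase p q x Hp Hq) as [-> ->].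
rewrite sin_plus; ring.
Qed.

(** * Boundary expression and Christoffel-Darboux formula *)

Definition boundary (pm qm pp qp : R) (m : nat) (x : R) : R :=
  sin_bs pm qm (INR m + 1) x - (pp + qp) * sin_bs pm qm (INR m) x
  + pp * qp * sin_bs pm qm (INR m - 1) x.

(** The expression is [modulus pm qm x] times the imaginary part of exp(i al) (exp(ix) - b_+ + a_+
    exp(-ix)), with al = m x + phase_-. The last factor is exp(ix) (1 - p_+ exp(-ix)) (1 - q_+
    exp(-ix)), so its phase adds to al. *)
Lemma boundary_polar (pm qm pp qp : R) (m : nat) (x : R) :
  -1 < pm < 1 -> -1 < qm < 1 -> -1 < pp < 1 -> -1 < qp < 1 ->
  boundary pm qm pp qp m x
  = modulus pm qm x * modulus pp qp x * sin (bethe pm qm pp qp m x / 2).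
Proof.
intros Hpm Hqm Hpp Hqp; unfold boundary; rewrite !sin_bs_polar by assumption.
destruct (modulus_phase pp qp x Hpp Hqp) as [Hc Hs].
set (al := INR m * x + phase pm qm x).
replace ((INR m + 1) * x + phase pm qm x) with (al + x) by (unfold al; ring).
replace ((INR m - 1) * x + phase pm qm x) with (al - x) by (unfold al; ring).
replace (bethe pm qm pp qp m x / 2) with (al + phase pp qp x)
  by (unfold al, bethe, phase; field).
rewrite !sin_plus, sin_minus.
transitivity (modulus pm qm x * (sin al * (modulus pp qp x * cos (phase pp qp x))
  + cos al * (modulus pp qp x * sin (phase pp qp x)))); [rewrite <- Hc, <- Hs |]; ring.
Qed.

(** Retaining the factor sin x sin y avoids division and keeps the kernel differentiable in y
    everywhere. *)
Definition bs_kernel (pm qm pp qp : R) (m : nat) (x y : R) : R :=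
  sum_n (fun l => sin_bs pm qm (INR l) x * sin_bs pm qm (INR l) y
                  * weight pm qm pp qp m l) m.

Lemma weight_interior (pm qm pp qp : R) (m l : nat) :
  (0 < l)%nat -> (l < m)%nat -> weight pm qm pp qp m l = 1.
Proof.
intros H0 Hm; unfold weight, kron0.
destruct (Z.eq_dec (Z.of_nat l) 0); [lia |].
destruct (Z.eq_dec (Z.of_nat m - Z.of_nat l) 0); [lia |].
field.
Qed.

Lemma weight_left (pm qm pp qp : R) (m : nat) :
  (1 <= m)%nat -> weight pm qm pp qp m 0 = / (1 - pm * qm).
Proof.
intros Hm; unfold weight, kron0.
destruct (Z.eq_dec (Z.of_nat m - Z.of_nat 0) 0); [lia |].
simpl; rewrite Rmult_1_r, Rmult_0_r, Rminus_0_r, Rinv_1; ring.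
Qed.

Lemma weight_right (pm qm pp qp : R) (m : nat) :
  (1 <= m)%nat -> weight pm qm pp qp m m = / (1 - pp * qp).
Proof.
intros Hm; unfold weight, kron0.
destruct (Z.eq_dec (Z.of_nat m) 0); [lia |].
destruct (Z.eq_dec (Z.of_nat m - Z.of_nat m) 0); [| lia].
rewrite Rmult_1_r, Rmult_0_r, Rminus_0_r, Rinv_1; ring.
Qed.

(** The sum telescopes by the recurrence. It starts correctly because the weight at 0 cancels one of
    the two factors 1 - a_- from [sin_bs_0]; the bound n < m keeps the right-hand weight out. *)
Lemma christoffel_darboux (pm qm pp qp : R) (m n : nat) (x y : R) :
  1 - pm * qm <> 0 -> (n < m)%nat ->
  2 * (cos x - cos y)
  * sum_n (fun l => sin_bs pm qm (INR l) x * sin_bs pm qm (INR l) y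
                    * weight pm qm pp qp m l) n
  = sin_bs pm qm (INR n + 1) x * sin_bs pm qm (INR n) y
    - sin_bs pm qm (INR n) x * sin_bs pm qm (INR n + 1) y.
Proof.
intros Ha; induction n as [| n IH]; intros Hn.
- rewrite sum_O, weight_left by lia.
  replace (INR 0 + 1) with 1 by (simpl; ring); change (INR 0) with 0.
  rewrite !sin_bs_0, !sin_bs_1; field; exact Ha.
- rewrite sum_Sn, weight_interior by lia; change plus with Rplus; cbv beta.
  rewrite Rmult_plus_distr_l, IH by lia; rewrite <- S_INR.
  pose proof (sin_bs_rec pm qm (INR (S n)) x) as Hx.
  pose proof (sin_bs_rec pm qm (INR (S n)) y) as Hy.
  replace (INR (S n) - 1) with (INR n) in * by (rewrite S_INR; ring).
  replace (sin_bs pm qm (INR (S n) + 1) x)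
    with (2 * cos x * sin_bs pm qm (INR (S n)) x - sin_bs pm qm (INR n) x) by lra.
  replace (sin_bs pm qm (INR (S n) + 1) y)
    with (2 * cos y * sin_bs pm qm (INR (S n)) y - sin_bs pm qm (INR n) y) by lra.
  ring.
Qed.

Lemma bs_kernel_boundary (pm qm pp qp : R) (m : nat) (x y : R) :
  1 - pm * qm <> 0 -> 1 - pp * qp <> 0 -> (1 <= m)%nat ->
  boundary pm qm pp qp m x = 0 ->
  2 * (cos x - cos y) * bs_kernel pm qm pp qp m x y
  = - (sin_bs pm qm (INR m) x / (1 - pp * qp)) * boundary pm qm pp qp m y.
Proof.
intros Ham Hap Hm Hx; unfold bs_kernel.
pose proof (weight_right pm qm pp qp m Hm) as Hw.
pose proof (sin_bs_rec pm qm (INR m) x) as Hrx; pose proof (sin_bs_rec pm qm (INR m) y) as Hry.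
unfold boundary in *.
destruct m as [| n]; [lia |].
rewrite sum_Sn; change plus with Rplus; cbv beta.
rewrite Hw, Rmult_plus_distr_l, (christoffel_darboux pm qm pp qp (S n) n) by (trivial; lia).
rewrite <- S_INR.
replace (INR (S n) - 1) with (INR n) in * by (rewrite S_INR; ring).
set (x0 := sin_bs pm qm (INR n) x) in *; set (x1 := sin_bs pm qm (INR (S n)) x) in *.
set (y0 := sin_bs pm qm (INR n) y) in *; set (y1 := sin_bs pm qm (INR (S n)) y) in *.
set (x2 := sin_bs pm qm (INR (S n) + 1) x) in *; set (y2 := sin_bs pm qm (INR (S n) + 1) y) in *.
(* The boundary condition at x, with index m + 1 eliminated by the recurrence, determines the value
   at m - 1 from the one at m. The result then factors through [x1]. *)
assert (Hx2 : x0 = x1 * (2 * cos x - (pp + qp)) / (1 - pp * qp)).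
{ replace x2 with (2 * cos x * x1 - x0) in Hx by lra.
  apply (Rmult_eq_reg_r (1 - pp * qp)); [field_simplify; trivial; lra | exact Hap]. }
replace y2 with (2 * cos y * y1 - y0) by lra.
rewrite Hx2; field; exact Hap.
Qed.

(** * The diagonal of the kernel *)

Lemma is_derive_bethe (pm qm pp qp : R) (m : nat) (x : R) :
  -1 < pm < 1 -> -1 < qm < 1 -> -1 < pp < 1 -> -1 < qp < 1 ->
  is_derive (bethe pm qm pp qp m) x (Hfun pm qm pp qp m x).
Proof.
intros Hpm Hqm Hpp Hqp; unfold bethe, Hfun; auto_derive.
- repeat split; eexists; now apply is_derive_vq.
- change (fun u => vq pm u) with (vq pm); change (fun u => vq qm u) with (vq qm).
  change (fun u => vq pp u) with (vq pp); change (fun u => vq qp u) with (vq qp).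
  ring.
Qed.

Lemma ex_derive_modulus (p q x : R) : -1 < p < 1 -> -1 < q < 1 ->
  ex_derive (modulus p q) x.
Proof.
intros Hp Hq; unfold modulus, vq_den; auto_derive.
pose proof (vq_den_pos p x Hp); pose proof (vq_den_pos q x Hq); simpl in *.
repeat split; lra.
Qed.

Lemma ex_derive_bs_kernel (pm qm pp qp : R) (m : nat) (x y : R) :
  ex_derive (bs_kernel pm qm pp qp m x) y.
Proof.
apply (ex_derive_sum_n (fun l t => sin_bs pm qm (INR l) x * sin_bs pm qm (INR l) t
                                   * weight pm qm pp qp m l)); intros l _; unfold sin_bs; auto_derive; trivial.
Qed.

(** Both sides of [bs_kernel_boundary] are differentiated in y at x. As cos x - cos y and sin (bethe
    y / 2) vanish there, the derivatives of the kernel and of the moduli drop out. *)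
Lemma bs_kernel_diag (pm qm pp qp : R) (m : nat) (x : R) :
  -1 < pm < 1 -> -1 < qm < 1 -> -1 < pp < 1 -> -1 < qp < 1 ->
  (1 <= m)%nat -> sin x <> 0 -> sin (bethe pm qm pp qp m x / 2) = 0 ->
  4 * bs_kernel pm qm pp qp m x x = modulus pm qm x ^ 2 * Hfun pm qm pp qp m x.
Proof.
intros Hpm Hqm Hpp Hqp Hm Hs Hb.
assert (Ham : 0 < 1 - pm * qm) by nra.
assert (Hap : 0 < 1 - pp * qp) by nra.
set (th := bethe pm qm pp qp m x / 2) in *.
set (k := - (sin_bs pm qm (INR m) x / (1 - pp * qp))).
set (M := fun y => modulus pm qm y * modulus pp qp y).
assert (Hf : is_derive (fun y => 2 * (cos x - cos y) * bs_kernel pm qm pp qp m x y) x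
  (2 * sin x * bs_kernel pm qm pp qp m x x)).
{ auto_derive; [repeat split; apply ex_derive_bs_kernel |]; ring. }
assert (Hg : is_derive (fun y => k * (M y * sin (bethe pm qm pp qp m y / 2))) x
  (k * (M x * (cos th * (Hfun pm qm pp qp m x / 2))))).
{ assert (HM : ex_derive M x)
    by (apply (ex_derive_mult (modulus pm qm) (modulus pp qp)); now apply ex_derive_modulus).
  pose proof (is_derive_bethe pm qm pp qp m x Hpm Hqm Hpp Hqp) as HB.
  auto_derive; [repeat split; [exact HM | eexists; exact HB] |].
  replace (Derive (fun u : R => bethe pm qm pp qp m u) x) with (Hfun pm qm pp qp m x)
    by (symmetry; exact (is_derive_unique _ _ _ HB)).
  fold (Rdiv (bethe pm qm pp qp m x) 2); fold th; rewrite Hb; field. }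
assert (Hx : boundary pm qm pp qp m x = 0)
  by (rewrite boundary_polar by assumption; fold th; rewrite Hb; ring).
assert (E : 2 * sin x * bs_kernel pm qm pp qp m x x
  = k * (M x * (cos th * (Hfun pm qm pp qp m x / 2)))).
{ rewrite <- (is_derive_unique _ _ _ Hf), <- (is_derive_unique _ _ _ Hg).
  apply Derive_ext; intros y.
  rewrite bs_kernel_boundary, boundary_polar by (assumption || lra); reflexivity. }
(* Here m x + phase_- = th - phase_+ and sin th = 0, so the sine in [k] is -cos th sin phase_+; by
   [modulus_phase] the factor 1 - a_+ cancels. *)
assert (Hk : k * modulus pp qp x = modulus pm qm x * cos th * sin x).
{ unfold k; rewrite sin_bs_polar by assumption.
  replace (INR m * x + phase pm qm x) with (th - phase pp qp x)
    by (unfold th, bethe, phase; field).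
  destruct (modulus_phase pp qp x Hpp Hqp) as [_ Hps].
  rewrite sin_minus, Hb.
  transitivity (modulus pm qm x * cos th * (modulus pp qp x * sin (phase pp qp x)) / (1 - pp * qp));
    [field; lra |].
  rewrite <- Hps; field; lra. }
(* The sign cos th = 1 or -1 enters twice, so it disappears as a square. *)
pose proof (sin2_cos2 th) as Hcs; rewrite Hb in Hcs; unfold Rsqr in Hcs.
apply (Rmult_eq_reg_l (sin x)); [| exact Hs].
transitivity (2 * (2 * sin x * bs_kernel pm qm pp qp m x x)); [ring |].
rewrite E; unfold M.
transitivity ((k * modulus pp qp x) * modulus pm qm x * cos th * Hfun pm qm pp qp m x); [field |].
rewrite Hk.
transitivity (sin x * (modulus pm qm x ^ 2 * Hfun pm qm pp qp m x) * (cos th * cos th)); [ring |].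
replace (cos th * cos th) with 1 by lra; ring.
Qed.

(** * Norm of the c-function and passage to the complex sums *)

Lemma cfun_norm (p q x : R) : -1 < p < 1 -> -1 < q < 1 -> sin x <> 0 ->
  (cfun p q x * cfun p q (- x))%C = RtoC (modulus p q x ^ 2 / (4 * sin x ^ 2)).
Proof.
intros Hp Hq Hs; assert (Hs' : sin (- x) <> 0) by (rewrite sin_neg; lra).
rewrite (cfun_eq p q x Hs), (cfun_eq p q (- x) Hs'), sin_neg, cos_neg.
(* c(-x) is the conjugate of c(x), so the product is a squared modulus. *)
assert (E : modulus p q x ^ 2
  = ((1 + p * q) * cos x - (p + q)) ^ 2 + ((1 - p * q) * sin x) ^ 2).
{ destruct (modulus_phase p q x Hp Hq) as [-> ->].
  pose proof (sin2_cos2 (phase p q x)) as Hcs; unfold Rsqr in Hcs.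
  transitivity (modulus p q x ^ 2 * 1); [ring | rewrite <- Hcs; ring]. }
rewrite E; apply injective_projections; simpl; field; trivial.
Qed.

Lemma sum_n_RtoC (f : nat -> R) (n : nat) :
  sum_n (fun l => RtoC (f l)) n = RtoC (sum_n f n).
Proof.
induction n as [| n IH]; [now rewrite !sum_O |].
rewrite !sum_Sn, IH; symmetry; apply RtoC_plus.
Qed.

Lemma sin_half_bethe_node (pm qm pp qp : R) (m lhat : nat) :
  -1 < pm < 1 -> -1 < qm < 1 -> -1 < pp < 1 -> -1 < qp < 1 -> (1 <= m)%nat ->
  sin (bethe pm qm pp qp m (node pm qm pp qp m lhat) / 2) = 0.
Proof.
intros Hpm Hqm Hpp Hqp Hm; rewrite node_spec by assumption.
apply sin_eq_0_1; exists (Z.of_nat (S lhat)).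
rewrite <- INR_IZR_INZ, S_INR; field.
Qed.

Lemma Hfun_pos (pm qm pp qp : R) (m : nat) (x : R) :
  -1 < pm < 1 -> -1 < qm < 1 -> -1 < pp < 1 -> -1 < qp < 1 ->
  0 < Hfun pm qm pp qp m x.
Proof.
intros Hpm Hqm Hpp Hqp; unfold Hfun.
rewrite (is_derive_unique _ _ _ (is_derive_vq pm x Hpm)),
  (is_derive_unique _ _ _ (is_derive_vq qm x Hqm)),
  (is_derive_unique _ _ _ (is_derive_vq pp x Hpp)),
  (is_derive_unique _ _ _ (is_derive_vq qp x Hqp)).
pose proof (vq_integrand_pos pm x Hpm); pose proof (vq_integrand_pos qm x Hqm).
pose proof (vq_integrand_pos pp x Hpp); pose proof (vq_integrand_pos qp x Hqp).
pose proof (pos_INR m); lra.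
Qed.

Theorem proposition2p2 (m : nat) (pm qm pp qp : R)
  (hm : (1 <= m)%nat)
  (hminus : -1 < pm /\ pm <= qm /\ qm < 1)
  (hplus : -1 < pp /\ pp <= qp /\ qp < 1)
  (lhat khat : nat) (hl : (lhat <= m)%nat) (hk : (khat <= m)%nat) :
  sum_n (fun l : nat => (bs_psi pm qm pp qp m lhat l * bs_psi pm qm pp qp m khat l
                         * RtoC (weight pm qm pp qp m l))%C) m
  = (if Nat.eq_dec khat lhat then (1 / dual_weight pm qm pp qp m lhat)%C
     else RtoC 0).
Proof.
assert (Hpm : -1 < pm < 1) by lra; assert (Hqm : -1 < qm < 1) by lra.
assert (Hpp : -1 < pp < 1) by lra; assert (Hqp : -1 < qp < 1) by lra.
set (x := node pm qm pp qp m lhat); set (y := node pm qm pp qp m khat).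
assert (Hsx : 0 < sin x)
  by (pose proof (node_bounds pm qm pp qp m lhat Hpm Hqm Hpp Hqp hm hl); now apply sin_gt_0).
assert (Hsy : 0 < sin y)
  by (pose proof (node_bounds pm qm pp qp m khat Hpm Hqm Hpp Hqp hm hk); now apply sin_gt_0).
(* The nodes lie in (0, PI), so the sines can be divided out and the sum becomes a real kernel. *)
transitivity (RtoC (bs_kernel pm qm pp qp m x y * / (sin x * sin y))).
{ unfold bs_kernel.
  rewrite <- (sum_n_mult_r (K := R_Ring) (/ (sin x * sin y))), <- sum_n_RtoC.
  apply sum_n_ext; intros l; unfold bs_psi; fold x y.
  rewrite !bs_poly_eq, <- !RtoC_mult, <- INR_IZR_INZ by lra.
  f_equal; change mult with Rmult; field; lra. }
assert (Hbx : sin (bethe pm qm pp qp m x / 2) = 0) by now apply sin_half_bethe_node.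
destruct (Nat.eq_dec khat lhat) as [e | ne].
- subst khat; change y with x.
  pose proof (bs_kernel_diag pm qm pp qp m x Hpm Hqm Hpp Hqp hm ltac:(lra) Hbx) as HK.
  pose proof (Hfun_pos pm qm pp qp m x Hpm Hqm Hpp Hqp) as HH.
  pose proof (modulus_pos pm qm x Hpm Hqm) as HM.
  unfold dual_weight; fold x; cbv zeta.
  rewrite cfun_norm, <- RtoC_mult by (assumption || lra).
  set (N := modulus pm qm x ^ 2 / (4 * sin x ^ 2) * Hfun pm qm pp qp m x).
  (* [N] is the denominator of [dual_weight]; being nonzero, it is recovered from 1 / (1 / N). *)
  assert (HN : 0 < N)
    by (apply Rmult_lt_0_compat; [apply Rdiv_lt_0_compat; nra | exact HH]).
  rewrite <- !RtoC_div by (try apply Rgt_not_eq, Rdiv_lt_0_compat; lra).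
  f_equal; transitivity N; [| field; lra].
  unfold N; replace (bs_kernel pm qm pp qp m x x) with (modulus pm qm x ^ 2 * Hfun pm qm pp qp m x / 4)
    by lra.
  field; lra.
(* The boundary expression vanishes at both nodes, while cos x - cos y does not, so the kernel
   must. *)
- assert (Hcos : cos x <> cos y)
    by (intros H; apply cos_node_inj in H; trivial; congruence).
  assert (HX : boundary pm qm pp qp m x = 0)
    by (rewrite boundary_polar, Hbx by assumption; ring).
  assert (HY : boundary pm qm pp qp m y = 0)
    by (unfold y; rewrite boundary_polar, sin_half_bethe_node by assumption; ring).
  pose proof (bs_kernel_boundary pm qm pp qp m x y ltac:(nra) ltac:(nra) hm HX) as HK.
  rewrite HY, Rmult_0_r in HK; f_equal.
  apply Rmult_integral in HK; destruct HK as [HK | HK]; [lra | rewrite HK; ring].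
Qed.
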